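(* Let $C_3=\{(x,y)\in\mathbb{R}^2: x^3+y^3=1\}$, whose asymptote is the line $x+y=0$. The area between $C_3$ and its asymptote is trisected by the coordinate axes; that is, the coordinate axes divide the region $\{(x,y)\in\mathbb{R}^2: x+y\ge 0,\ x^3+y^3\le 1\}$ into three parts (its intersections with the first, second and fourth quadrants), and these three parts have equal finite area. *)

(* Defs.v *)
From HB Require Import structures.
From mathcomp Require Import all_boot all_order all_algebra.
From mathcomp Require Import all_classical all_reals all_analysis.

Set Implicit Arguments.
Unset Strict Implicit.
Unset Printing Implicit Defensive.

Import Order.TTheory GRing.Theory Num.Theory.
Import numFieldNormedType.Exports.

Local Open Scope classical_set_scope.
Local Open Scope ring_scope.

Definition is_line (R : realType) (L : set (R * R)) : Prop :=
  exists a b c : R,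
    (a, b) != (0, 0) /\ L = [set p | a * p.1 + b * p.2 = c].

(* [L] is an asymptote of the curve [C]: some branch of [C], parametrized by
   [g] on [0, +oo[, goes to infinity while its distance to [L] tends to 0.
   The norm and distance of [R * R] are those of the sup norm; by equivalence
   of norms the notion is the same as for the Euclidean ones. *)
Definition asymptote (R : realType) (C L : set (R * R)) : Prop :=
  is_line L /\
  exists g : R -> R * R,
    [/\ {within `[0, +oo[, continuous g},
        (forall t, 0 <= t -> C (g t)),
        `|g t| @[t --> +oo] --> +oo &
        edist_inf L (g t) @[t --> +oo] --> 0%E].

Definition C3 (R : realType) : set (R * R) :=
  [set p | p.1 ^+ 3 + p.2 ^+ 3 = 1].

Definition region3 (R : realType) : set (R * R) :=
  [set p | 0 <= p.1 + p.2 /\ p.1 ^+ 3 + p.2 ^+ 3 <= 1].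

Definition quadrant1 (R : realType) : set (R * R) :=
  [set p | 0 <= p.1 /\ 0 <= p.2].

Definition quadrant2 (R : realType) : set (R * R) :=
  [set p | p.1 <= 0 /\ 0 <= p.2].

Definition quadrant4 (R : realType) : set (R * R) :=
  [set p | 0 <= p.1 /\ p.2 <= 0].

Definition axes (R : realType) : set (R * R) :=
  [set p | p.1 = 0 \/ p.2 = 0].

Arguments C3 R : clear implicits.
Arguments region3 R : clear implicits.
Arguments quadrant1 R : clear implicits.
Arguments quadrant2 R : clear implicits.
Arguments quadrant4 R : clear implicits.
Arguments axes R : clear implicits.

Definition area (R : realType) (A : set (R * R)) : \bar R :=
  ((@lebesgue_measure R) \x (@lebesgue_measure R))%E A.

(* Product of the Borel sigma-algebra of [R] with itself. *)
Definition borel2 (R : realType) (A : set (R * R)) : Prop :=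
  measurable (A : set (measurableTypeR R * measurableTypeR R)).

(* Main.v *)
Require Import Defs.
From HB Require Import structures.
From mathcomp Require Import all_boot all_order all_algebra.
From mathcomp Require Import all_classical all_reals all_analysis.
From mathcomp Require Import measurable_realfun.
From mathcomp Require Import ring lra.

Set Implicit Arguments.
Unset Strict Implicit.
Unset Printing Implicit Defensive.

Import Order.TTheory GRing.Theory Num.Theory.
Import numFieldNormedType.Exports.

Local Open Scope classical_set_scope.
Local Open Scope ring_scope.

(** The equality of the three areas is invisible in Cartesian slices and clear
in polar ones. A sector with apex at the origin bounded by a plane curve has
area one half of the integral of x dy - y dx along the curve, and on
x^3 + y^3 = 1 this form equals - dx / y^2, the invariant differential of the
Fermat cubic X^3 + Y^3 = Z^3. The projective symmetry exchanging X and Z with a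
sign, (x, y) |-> (1/x, -y/x), preserves the cubic and that differential up to
sign; it maps the arc in the first quadrant onto the arc in the fourth one, so
sectors over corresponding arcs have equal areas.

With z = (x^3 - 1)^(1/3), the slices of the first quadrant part have length
(1 - x^3)^(1/3), those of the fourth quadrant part have length x - z, and equality
of the sectors becomes an explicit antiderivative of x - z on [1, +oo[,
  x (x - z) / 2 + z / (2 x^2) - I(1/x),
where I(u) is the integral of (1 - t^3)^(1/3) over [0, u]. The first term is a
triangle between the curve and the asymptote, the other two are, up to a
constant, the sector of the first quadrant seen through the symmetry. This
function tends to 0 at +oo because x - z <= 1/x^2, and equals 1/2 - I(1) at 1;
hence the slices over [1, +oo[ have total area I(1) - 1/2 ([integral_tail]).
The triangle over [0, 1] adds 1/2, and I(1) is the area of the first quadrant part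
([area_D1], [area_D4]). The second quadrant part is the mirror image of the fourth
([area_swap]), and the parts overlap only on the axes, a null set ([area_setU]).

For the asymptote, (x + y) (x^2 - x y + y^2) = 1 on the curve, so x + y tends
to 0 along any branch going to infinity. If the distance to the line
a x + b y = c tends to 0, then a x + b y = (a - b) x + b (x + y) tends to c
while x is unbounded, which forces a = b and c = 0
([asymptote_C3_unique]); the arc in the fourth quadrant is a branch that does
approach x + y = 0 ([asymptote_C3_antidiagonal]). *)

(** * Real cube root of the positive part *)

Section cube_root.
Context {R : realType}.
Implicit Types x y : R.

(** Truncation at 0 makes the function continuous on the whole line, the power
of a negative base being 1 by convention. *)
Definition cbrt (y : R) : R := (Num.max 0 y) `^ 3^-1.

Lemma cbrt_ge0 y : 0 <= cbrt y.
Proof. exact: powR_ge0. Qed.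

Lemma cbrt_pow3 y : cbrt y ^+ 3 = Num.max 0 y.
Proof.
have m0 : 0 <= Num.max 0 y by rewrite le_max lexx.
by rewrite /cbrt -powR_mulrn ?powR_ge0// -powRrM mulVf ?pnatr_eq0// powRr1.
Qed.

Lemma cbrtK y : 0 <= y -> cbrt y ^+ 3 = y.
Proof. by move=> y0; rewrite cbrt_pow3 max_r. Qed.

Lemma pow3_inj x y : 0 <= x -> 0 <= y -> x ^+ 3 = y ^+ 3 -> x = y.
Proof. by move=> x0 y0 /eqP; rewrite eqrXn2// => /eqP. Qed.

Lemma cbrt_npos y : y <= 0 -> cbrt y = 0.
Proof.
move=> y0; apply: pow3_inj => //; first exact: cbrt_ge0.
by rewrite cbrt_pow3 max_l// expr0n.
Qed.

Lemma cbrt_gt0 y : 0 < y -> 0 < cbrt y.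
Proof. by move=> y0; rewrite powR_gt0// lt_max y0 orbT. Qed.

Lemma le_cbrt x y : 0 <= x -> 0 <= y -> (x <= cbrt y) = (x ^+ 3 <= y).
Proof.
by move=> x0 y0; rewrite -(@ler_pXn2r _ 3) ?nnegrE ?cbrt_ge0// cbrtK.
Qed.

Lemma cbrt_le x y : 0 <= x -> (cbrt y <= x) = (y <= x ^+ 3).
Proof.
move=> x0; rewrite -(@ler_pXn2r _ 3) ?nnegrE ?cbrt_ge0// cbrt_pow3 ge_max.
by rewrite exprn_ge0.
Qed.

(** For 0 <= p <= q, (q - p)^3 <= q^3 - p^3: the function is Hoelder continuous of
exponent 1/3, with constant 1, including at its singularity 0. *)
Lemma continuous_cbrt : continuous cbrt.
Proof.
move=> a; apply/cvgrPdist_lt => e e0.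
have e30 : 0 < e ^+ 3 by rewrite exprn_gt0.
near=> b.
have ab : `|a - b| < e ^+ 3 by near: b; exact: cvgr_dist_lt.
have hl u v : cbrt u <= cbrt v -> (cbrt v - cbrt u) ^+ 3 <= `|u - v|.
  move=> uv; have := cbrt_pow3 u; have := cbrt_pow3 v.
  have := cbrt_ge0 u; move: uv; set p := cbrt u; set q := cbrt v => pq p0 qv pu.
  have : (q - p) ^+ 3 <= q ^+ 3 - p ^+ 3.
    rewrite -subr_ge0 [X in 0 <= X](_ : _ = 3 * (q * p * (q - p))); last by ring.
    by rewrite !mulr_ge0 ?subr_ge0// (le_trans p0).
  move/le_trans; apply; rewrite qv pu.
  by case: (leP 0 u) => ?; case: (leP 0 v) => ?; case: ger0P => ?; lra.
rewrite -(@ltr_pXn2r _ 3)// ?nnegrE// ?(ltW e0)// (le_lt_trans _ ab)//.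
have [|/ltW] := leP (cbrt a) (cbrt b); move=> /[dup] /hl H abc.
- by rewrite distrC ger0_norm ?subr_ge0.
- by rewrite ger0_norm ?subr_ge0// (distrC a).
Unshelve. all: by end_near. Qed.

Lemma is_derive_cbrt y : 0 < y -> is_derive y 1 cbrt (3 * cbrt y ^+ 2)^-1.
Proof.
move=> y0.
apply: (@near_eq_is_derive _ _ _ (fun z : R => z `^ 3^-1)) => //.
  near=> z; rewrite /cbrt max_r//; apply/ltW; near: z; exact: lt_nbhsr.
have dp := is_derive1_powR (3^-1) y0; apply: is_derive_eq.
have c0 := cbrt_gt0 y0; have cy := cbrtK (ltW y0).
rewrite powRB ?(gt_eqF y0) ?implybT// powRr1 ?ltW//.
have -> : y `^ 3^-1 = cbrt y by rewrite /cbrt max_r// ltW.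
by rewrite -{2}cy; field; rewrite gt_eqF.
Unshelve. all: by end_near. Qed.

End cube_root.

(** * The two arcs and the area below the first one *)

Section antiderivative.
Context {R : realType}.
Notation mu := (@lebesgue_measure R).
Implicit Types x u : R.

(** Height of the arc in the first quadrant, 0 for x >= 1. *)
Definition arc1 x : R := cbrt (1 - x ^+ 3).

(** Opposite of the height of the arc in the fourth quadrant, extended by 0 to
x <= 1, where that part of the region is bounded by the horizontal axis. *)
Definition arc4 x : R := cbrt (x ^+ 3 - 1).

Lemma continuous_arc1 : continuous arc1.
Proof.
move=> x; apply: (@continuous_comp _ _ _ (fun x => 1 - x ^+ 3) cbrt).
  by apply: cvgB; [exact: cvg_cst|exact: exprn_continuous].
exact: continuous_cbrt.
Qed.

Lemma continuous_arc4 : continuous arc4.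
Proof.
move=> x; apply: (@continuous_comp _ _ _ (fun x => x ^+ 3 - 1) cbrt).
  by apply: cvgB; [exact: exprn_continuous|exact: cvg_cst].
exact: continuous_cbrt.
Qed.

Lemma arc4_gt0 x : 1 < x -> 0 < arc4 x.
Proof. by move=> x1; rewrite cbrt_gt0// subr_gt0 exprn_egt1. Qed.

Lemma arc4K x : 1 <= x -> arc4 x ^+ 3 = x ^+ 3 - 1.
Proof. by move=> x1; rewrite cbrtK// subr_ge0 exprn_ege1. Qed.

Lemma arc4_le x : 0 <= x -> arc4 x <= x.
Proof. by move=> x0; rewrite cbrt_le// gerDl lerN10. Qed.

(** The symmetry (x, y) |-> (1/x, -y/x) exchanges the two arcs. *)
Lemma arc1V x : 1 <= x -> arc1 x^-1 = arc4 x / x.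
Proof.
move=> x1; have x0 : 0 < x by rewrite (lt_le_trans ltr01).
apply: pow3_inj; first exact: cbrt_ge0.
  by rewrite divr_ge0 ?cbrt_ge0// ltW.
rewrite exprMn arc4K// cbrtK; last first.
  by rewrite exprVn subr_ge0 invf_le1 ?exprn_gt0// exprn_ege1.
by field; rewrite gt_eqF.
Qed.

(** From (x - z) (x^2 + x z + z^2) = x^3 - z^3 = 1 with x, z >= 0. *)
Lemma sub_arc4_le x : 1 <= x -> x - arc4 x <= x ^- 2.
Proof.
move=> x1; have x0 : 0 < x by rewrite (lt_le_trans ltr01).
have z0 : 0 <= arc4 x by exact: cbrt_ge0.
rewrite -[leRHS]mul1r ler_pdivlMr ?exprn_gt0//.
have zx := arc4_le (ltW x0).
have := arc4K x1; set z := arc4 x in z0 zx * => zK.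
rewrite -[leRHS](_ : (x - z) * (x ^+ 2 + x * z + z ^+ 2) = 1); last first.
  by rewrite [LHS](_ : _ = x ^+ 3 - z ^+ 3); [rewrite zK; ring|ring].
rewrite ler_wpM2l ?subr_ge0// -addrA lerDl addr_ge0 ?mulr_ge0 ?exprn_ge0//.
exact: ltW.
Qed.

Lemma is_derive_arc4 x : 1 < x -> is_derive x 1 arc4 (x ^+ 2 / arc4 x ^+ 2).
Proof.
move=> x1.
have d1 : is_derive x 1 (fun x : R => x ^+ 3 - 1) (3 * x ^+ 2).
  by apply: is_derive_eq; rewrite /GRing.scale /=; ring.
have y0 : 0 < x ^+ 3 - 1 by rewrite subr_gt0 exprn_egt1.
have d2 := is_derive_cbrt y0.
have /is_derive_eq := @is_derive1_comp _ _ (fun x : R => x ^+ 3 - 1) _ _ _ d2 d1.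
apply.
rewrite -/(arc4 x); have := arc4_gt0 x1; set z := arc4 x => z0.
by field; rewrite gt_eqF.
Qed.

Definition arc1_integral u : R := (\int[mu]_(t in `[0, u]) arc1 t)%R.

Lemma integrable_arc1 a b : mu.-integrable `[a, b] (EFin \o arc1).
Proof.
apply: continuous_compact_integrable; first exact: segment_compact.
exact/continuous_subspaceT/continuous_arc1.
Qed.

Lemma is_derive_arc1_integral u : 0 < u ->
  is_derive u 1 arc1_integral (arc1 u).
Proof.
move=> u0; have uu : u < u + 1 by rewrite ltrDl.
have [d e] := @continuous_FTC1_closed _ arc1 0 u _ uu (integrable_arc1 _ _) u0
  (@continuous_arc1 u).
by apply: DeriveDef => //; rewrite -derive1E.
Qed.

End antiderivative.

(** * The unbounded part of the fourth quadrant region *)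

Section tail_integral.
Context {R : realType}.
Notation mu := (@lebesgue_measure R).
Implicit Types x : R.

(** A triangle plus a sector of the first quadrant, minus the constant I(1). *)
Let F x : R := 2^-1 * (x * (x - arc4 x)) + 2^-1 * (arc4 x * x^-1 ^+ 2)
  - arc1_integral x^-1.

(** Differentiating I(1/x) gives - (z/x) / x^2 by [arc1V], which cancels the
derivative of the factor x^-2 in the second term. *)
Let is_derive_F x : 1 < x -> is_derive x 1 F (x - arc4 x).
Proof.
move=> x1; have x0 : 0 < x by rewrite (lt_trans ltr01).
have z0 := arc4_gt0 x1; have zK := arc4K (ltW x1).
have dz := is_derive_arc4 x1.
have dV : is_derive x 1 (fun x : R => x^-1) (- x ^- 2).
  have /is_derive_eq := @is_deriveV _ id x 1 1 (lt0r_neq0 x0) (is_derive_id _ _).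
  by apply; rewrite /GRing.scale /= mulr1.
have dI : is_derive x 1 (fun x : R => arc1_integral x^-1)
    (arc4 x / x * - x ^- 2).
  rewrite -arc1V 1?ltW//.
  apply: (@is_derive1_comp _ _ (fun x : R => x^-1)) dV.
  by apply: is_derive_arc1_integral; rewrite invr_gt0.
apply: is_derive_eq; rewrite /GRing.scale /=.
move: zK z0; set z := arc4 x => zK z0.
apply/eqP; rewrite -subr_eq0; apply/eqP.
(* The derivative of F is x - z plus a multiple of 1 - x^3 + z^3, zero on the
   curve. *)
transitivity ((1 - x ^+ 3 + z ^+ 3) / (2 * z ^+ 2)); last first.
  by rewrite zK; field; rewrite gt_eqF.
by field; rewrite !gt_eqF.
Qed.

Lemma cvg_inv_pinfty : x^-1 @[x --> +oo] --> (0 : R).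
Proof.
apply/cvgrPdist_lt => e e0; near=> x.
have x0 : 0 < x by near: x; exact: nbhs_pinfty_gt.
rewrite sub0r normrN gtr0_norm ?invr_gt0// invf_plt ?posrE//.
by near: x; apply: nbhs_pinfty_gt; exact: num_real.
Unshelve. all: by end_near. Qed.

Let cvg_F_pinfty : F x @[x --> +oo] --> (0 : R).
Proof.
rewrite -[X in _ --> X](_ : 2^-1 * 0 + 2^-1 * 0 - 0 = 0 :> R); last by ring.
apply: cvgB; [apply: cvgD; apply: cvgMl_tmp|].
- apply: (squeeze_cvgr (f := fun=> 0) (h := fun x => x^-1)).
  + near=> x; have x1 : 1 <= x by near: x; exact: nbhs_pinfty_ge.
    have x0 : 0 < x by rewrite (lt_le_trans ltr01).
    rewrite mulr_ge0 ?subr_ge0 ?arc4_le ?(ltW x0)//=.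
    have -> : x^-1 = x * x ^- 2 by field; rewrite gt_eqF.
    by rewrite ler_pM2l// sub_arc4_le.
  + exact: cvg_cst.
  + exact: cvg_inv_pinfty.
- apply: (squeeze_cvgr (f := fun=> 0) (h := fun x => x^-1)).
  + near=> x; have x0 : 0 < x by near: x; exact: nbhs_pinfty_gt.
    rewrite mulr_ge0 ?cbrt_ge0 ?exprn_ge0 ?invr_ge0 ?(ltW x0)//=.
    rewrite [leRHS](_ : _ = x * x^-1 ^+ 2); last by field; rewrite gt_eqF.
    by rewrite ler_wpM2r ?arc4_le ?exprn_ge0 ?invr_ge0 ?(ltW x0).
  + exact: cvg_cst.
  + exact: cvg_inv_pinfty.
- apply: (cvg_comp _ _ cvg_inv_pinfty).
  exact: parameterized_integral_cvg_left ltr01 (integrable_arc1 _ _).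
Unshelve. all: by end_near. Qed.

Let cvg_F_at_right1 : F x @[x --> 1^'+] --> F 1.
Proof.
apply: cvg_at_right_filter.
have cV : x^-1 @[x --> (1 : R)] --> (1 : R)^-1 by apply: cvgV => //; exact: cvg_id.
have cz : arc4 x @[x --> (1 : R)] --> arc4 (1 : R) by exact: continuous_arc4.
apply: cvgB; [apply: cvgD; apply: cvgMl_tmp|].
- exact: (cvgM cvg_id (cvgB cvg_id cz)).
- exact: (cvgM cz (cvgM cV cV)).
- apply: (cvg_comp _ _ cV); apply: differentiable_continuous.
  apply/derivable1_diffP; rewrite invr1.
  by have [] := @is_derive_arc1_integral R _ ltr01.
Qed.

(** The integral is 0 - F 1, where F 1 = 1/2 - I(1) because z vanishes at 1. *)
Lemma integral_tail :
  (\int[mu]_(x in `[1%R, +oo[) (x - arc4 x)%:E)%E =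
  (arc1_integral 1 - 2^-1)%:E.
Proof.
rewrite (@ge0_continuous_FTC2y _ _ F _ 0).
- rewrite sub0e -EFinN; congr EFin.
  have -> : F 1 = 2^-1 - arc1_integral 1.
    by rewrite /F invr1 /arc4 expr1n subrr cbrt_npos//; ring.
  by rewrite opprB.
- by move=> x x1; rewrite subr_ge0 arc4_le// (le_trans ler01).
- apply: continuous_subspaceT => x.
  by apply: cvgB; [exact: cvg_id|exact: continuous_arc4].
- exact: cvg_F_pinfty.
- by move=> x x1; have [] := is_derive_F x1.
- exact: cvg_F_at_right1.
- move=> x; rewrite in_itv/= andbT => x1.
  by have [_ <-] := is_derive_F x1; rewrite derive1E.
Qed.

End tail_integral.

(** * Areas of the three parts *)

Section areas.
Context {R : realType}.
Notation mu := (@lebesgue_measure R).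

Lemma area_xsection (A : set (R * R)) (D : set R) (h : R -> \bar R) :
  (forall x, D x -> mu (xsection A x) = h x) ->
  (forall x, ~ D x -> xsection A x = set0) ->
  area A = (\int[mu]_(x in D) h x)%E.
Proof.
move=> AD AnD; rewrite /area /product_measure1 [RHS]integral_mkcond.
apply: eq_integral => x _; rewrite patchE /=.
by case: ifPn => [/set_mem/AD//|/negP]; rewrite inE => /AnD ->; rewrite measure0.
Qed.

(** Integrating the lengths of the vertical slices or of the horizontal ones
defines the same measure, by uniqueness of the product. *)
Lemma area_swap (A : set (R * R)) : borel2 A ->
  area [set p | A (p.2, p.1)] = area A.
Proof.
move=> mA; rewrite /area.
rewrite (@product_measure_unique _ _ _ _ _ mu mu (mu \x^ mu)%E _ A mA); last first.
  by move=> B C mB mC; exact: product_measure2E.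
rewrite /product_measure1 /= /product_measure2; apply: eq_integral => x _ /=.
by congr (mu _); apply/seteqP; split => y /=; rewrite !inE.
Qed.

Lemma measurable_sublevel (f : R * R -> R) (c : R) :
  measurable_fun setT (f : measurableTypeR R * measurableTypeR R -> measurableTypeR R) ->
  borel2 [set p | f p <= c].
Proof.
move=> mf; rewrite /borel2.
have := mf measurableT `]-oo, c]%classic (measurable_itv _).
rewrite setTI; congr measurable; apply/seteqP; split => p /=; rewrite in_itv//.
Qed.

Let measurable_fst2 : measurable_fun setT
  (fst : measurableTypeR R * measurableTypeR R -> measurableTypeR R).
Proof. exact: measurable_fst. Qed.

Let measurable_snd2 : measurable_fun setT
  (snd : measurableTypeR R * measurableTypeR R -> measurableTypeR R).
Proof. exact: measurable_snd. Qed.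

Let measurable_superlevel0 (f : R * R -> R) :
  measurable_fun setT (f : measurableTypeR R * measurableTypeR R -> measurableTypeR R) ->
  borel2 [set p | 0 <= f p].
Proof.
move=> mf; rewrite (_ : mkset _ = [set p | - f p <= 0]).
  by apply: measurable_sublevel; exact: measurableT_comp mf.
by apply/seteqP; split => p /=; rewrite oppr_le0.
Qed.

Lemma borel2_region3 : borel2 (region3 R).
Proof.
apply: measurableI.
  by apply: measurable_superlevel0; exact: measurable_funD.
apply: measurable_sublevel; apply: measurable_funD; exact: measurable_funX.
Qed.

Lemma borel2_quadrant1 : borel2 (quadrant1 R).
Proof. by apply: measurableI; exact: measurable_superlevel0. Qed.

Lemma borel2_quadrant2 : borel2 (quadrant2 R).
Proof.
by apply: measurableI; [exact: measurable_sublevel|exact: measurable_superlevel0].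
Qed.

Lemma borel2_quadrant4 : borel2 (quadrant4 R).
Proof.
by apply: measurableI; [exact: measurable_superlevel0|exact: measurable_sublevel].
Qed.

Lemma area_D1 : area (region3 R `&` quadrant1 R) = (arc1_integral (1 : R))%:E.
Proof.
rewrite (@area_xsection _ `[0, 1]%classic (fun x => (arc1 x)%:E)).
- rewrite /arc1_integral /Rintegral fineK//.
  exact: integrable_fin_num (integrable_arc1 0 1).
- move=> x; rewrite /= in_itv/= => /andP[x0 x1].
  rewrite (_ : xsection _ _ = `[0, arc1 x]%classic).
    rewrite lebesgue_measure_itv/= lte_fin -EFinD subr0.
    by case: ltgtP (cbrt_ge0 (1 - x ^+ 3)) => // <-.
  have s0 : 0 <= 1 - x ^+ 3 by rewrite subr_ge0 exprn_ile1.
  apply/seteqP; split => y; rewrite /xsection/= inE in_itv/=.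
    by move=> [[_ xy] [_ y0]]; rewrite y0 le_cbrt// lerBrDl.
  move=> /andP[y0]; rewrite le_cbrt// lerBrDl => xy.
  by split; split => //=; rewrite addr_ge0.
- move=> x; rewrite /= in_itv/= => xN.
  rewrite -subset0 => y; rewrite /xsection/= inE => -[[_ /= xy] [/= x0 y0]].
  apply: xN; rewrite x0/= -(@ler_pXn2r _ 3)// ?nnegrE// expr1n.
  by rewrite (le_trans _ xy)// lerDl exprn_ge0.
Qed.

Lemma integral_id01 : (\int[mu]_(x in `[0%R, 1%R]) x%:E = 2^-1%:E)%E.
Proof.
rewrite (@continuous_FTC2 _ id (fun x => 2^-1 * x ^+ 2) _ _ ltr01).
- by rewrite -EFinB expr0n expr1n /= mulr0 subr0 mulr1.
- by apply: continuous_subspaceT => x; exact: cvg_id.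
- have c (x : R) : (2^-1 * z ^+ 2 : R) @[z --> x] --> 2^-1 * x ^+ 2.
    by apply: cvgMl_tmp; exact: exprn_continuous.
  split; [by []|exact: cvg_at_right_filter|exact: cvg_at_left_filter].
- move=> x _; rewrite derive1E.
  have [_ ->//] : is_derive x 1 (fun x : R => 2^-1 * x ^+ 2) x.
  by apply: is_derive_eq; rewrite /GRing.scale /=; field.
Qed.

Lemma area_D4 : area (region3 R `&` quadrant4 R) = (arc1_integral (1 : R))%:E.
Proof.
have ge0 (x : R) : 0 <= x -> (0 <= (x - arc4 x)%:E)%E.
  by move=> x0; rewrite lee_fin subr_ge0 arc4_le.
rewrite (@area_xsection _ `[0, +oo[%classic (fun x => (x - arc4 x)%:E)).
- have mf (D : set R) : measurable_fun D (EFin \o (fun x => x - arc4 x)).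
    apply/measurable_EFinP; apply: measurable_funS (@subsetT _ D) _ => //.
    apply: continuous_measurable_fun => x.
    exact: cvgB cvg_id (@continuous_arc4 _ x).
  (* On [0, 1[ the slices form a triangle, since arc4 vanishes there. *)
  have -> : `[0, +oo[%classic = `[0, 1[%classic `|` `[1, +oo[%classic :> set R.
    by rewrite -itv_bndbnd_setU// bnd_simp.
  rewrite ge0_integral_setU//=; last 3 first.
  - exact: mf.
  - move=> x /= [|]; rewrite in_itv/=; first by move=> /andP[x0 _]; exact: ge0.
    by rewrite andbT => x1; apply: ge0; rewrite (le_trans ler01).
  - apply/disj_set2P; rewrite -subset0 => x/=; rewrite !in_itv/= => -[/andP[_]].
    by rewrite andbT ltNge => /negP.
  rewrite integral_tail integral_itv_bndo_bndc; last exact: mf.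
  rewrite (@eq_integral _ _ _ mu _ (fun x : R => x%:E)).
    by rewrite integral_id01 -EFinD; congr EFin; ring.
  move=> x /set_mem; rewrite /= in_itv/= => /andP[x0 x1].
  by rewrite /arc4 cbrt_npos ?subr0// subr_le0 exprn_ile1.
- move=> x; rewrite /= in_itv/= andbT => x0.
  rewrite (_ : xsection _ _ = `[- x, - arc4 x]%classic).
    rewrite lebesgue_measure_itv/= lte_fin -EFinD ltrN2 opprK addrC.
    by have := arc4_le x0; rewrite le_eqVlt => /predU1P[->|->]//; rewrite ltxx subrr.
  have yE (y : R) : y <= 0 -> (y <= - arc4 x) = (x ^+ 3 + y ^+ 3 <= 1).
    move=> y0; rewrite lerNr cbrt_le ?oppr_ge0// exprNn -signr_odd/= expr1 mulN1r.
    by rewrite lerBlDr addrC lerBrDr.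
  apply/seteqP; split => y; rewrite /xsection/= inE in_itv/=.
    by move=> [[/= xy xy3] [_ /= y0]]; rewrite yE// xy3 andbT lerNl -subr_ge0 opprK.
  move=> /andP[xy yz].
  have y0 : y <= 0 by rewrite (le_trans yz)// oppr_le0 cbrt_ge0.
  by split; split => //=; rewrite -?yE// -lerBlDl sub0r.
- move=> x; rewrite /= in_itv/= andbT => xN.
  by rewrite -subset0 => y; rewrite /xsection/= inE => -[_ [/= x0 y0]].
Qed.

Lemma area_D2 : area (region3 R `&` quadrant2 R) = (arc1_integral (1 : R))%:E.
Proof.
rewrite -area_D4 -[RHS]area_swap; last first.
  exact: measurableI borel2_region3 borel2_quadrant4.
congr area; apply/seteqP; split => -[x y] /= -[[s c] [q1 q2]];
  by do 2 split => //=; rewrite addrC.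
Qed.

Let axes_setX : axes R = ([set 0] `*` [set: R]) `|` ([set: R] `*` [set 0]).
Proof.
apply/seteqP; split => -[x y] /= [h|h]; [left|right|left|right] => //.
  by case: h.
by case: h.
Qed.

Lemma borel2_axes : borel2 (axes R).
Proof. by rewrite axes_setX; apply: measurableU; exact: measurableX. Qed.

Lemma area_axes : area (axes R) = 0%E.
Proof.
have E1 : area ([set (0 : R)] `*` [set: R]) = 0%E.
  transitivity (mu [set 0%R] * mu setT)%E; first exact: product_measure1E.
  by rewrite lebesgue_measure_set1 mul0e.
have E2 : area ([set: R] `*` [set (0 : R)]) = 0%E.
  transitivity (mu setT * mu [set 0%R])%E; first exact: product_measure1E.
  by rewrite lebesgue_measure_set1 mule0.
have U2 : (area (axes R) <=
    area ([set 0%R] `*` [set: R]) + area ([set: R] `*` [set 0%R]))%E.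
  by rewrite axes_setX; apply: measureU2; exact: measurableX.
apply/eqP; rewrite eq_le; apply/andP; split; last exact: measure_ge0.
by rewrite (le_trans U2)// E1 E2 adde0.
Qed.

Lemma area_setU (A B : set (R * R)) : borel2 A -> borel2 B ->
  A `&` B `<=` axes R -> (area A < +oo)%E ->
  area (A `|` B) = (area A + area B)%E.
Proof.
move=> mA mB AB Aoo.
have -> : area (A `|` B) = (area A + area B - area (A `&` B))%E.
  exact: measureUfinl.
suff -> : area (A `&` B) = 0%E by rewrite sube0.
apply/eqP; rewrite eq_le; apply/andP; split; last exact: measure_ge0.
rewrite -area_axes; apply: le_measure => //; rewrite inE.
  exact: measurableI.
exact: borel2_axes.
Qed.

End areas.

(** * The asymptote *)

Section asymptote_of_C3.
Context {R : realType}.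
Implicit Types a b c x y M : R.

(** Far from the origin N = x^2 - x y + y^2 is at least 3/4 M^2 >= M, while
(x + y) N = 1: so x + y is small, and the abscissa alone goes to infinity. *)
Let C3_far x y M : x ^+ 3 + y ^+ 3 = 1 -> 2 <= M -> M <= Num.max `|x| `|y| ->
  `|x + y| <= M^-1 /\ M - 1 <= `|x|.
Proof.
move=> xy1 M2 Mxy; have M0 : 0 < M by lra.
pose N := x ^+ 2 - x * y + y ^+ 2.
have sN : (x + y) * N = 1 by rewrite -xy1 /N; ring.
have MN : M <= N.
  have MM : M <= 3 / 4 * M ^+ 2 by nra.
  have sqr_le (u v : R) : M <= `|u| -> M <= u ^+ 2 - u * v + v ^+ 2.
    move=> Mu; have : M ^+ 2 <= u ^+ 2.
      by rewrite -(real_normK (num_real u)) lerXn2r// nnegrE ltW.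
    have := sqr_ge0 (v - u / 2); nra.
  move: Mxy; rewrite le_max => /orP[/sqr_le -> //|/sqr_le].
  by move=> /(_ x); rewrite /N; lra.
have s0 : 0 < x + y by nra.
have sM : `|x + y| <= M^-1.
  by rewrite gtr0_norm// -[leRHS]mul1r ler_pdivlMr//; nra.
split => //; move: Mxy; rewrite le_max => /orP[|My]; first lra.
have M1 : M^-1 <= 1 by rewrite invf_le1//; lra.
have : `|y| <= `|x + y| + `|x|.
  by rewrite -[X in `|X| <= _](_ : (x + y) - x = y) ?ler_normB//; ring.
lra.
Qed.

(** Along points of the curve close to the line, a x + b y - c is small, hence
(a - b) x - c is bounded while x is not: thus a = b, and then |c| is below every positive d. *)
Let line_far a b c : (a, b) != (0, 0) ->
  (forall M e, 0 < e -> exists p q : R * R,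
    [/\ p.1 ^+ 3 + p.2 ^+ 3 = 1, M <= `|p|, a * q.1 + b * q.2 = c,
        `|p.1 - q.1| < e & `|p.2 - q.2| < e]) ->
  a = b /\ c = 0.
Proof.
move=> ab0 far; set K := `|a| + `|b|.
have K0 : 0 <= K by rewrite addr_ge0.
have bound M e : 2 <= M -> 0 < e -> exists x,
    M - 1 <= `|x| /\ `|(a - b) * x - c| <= K * e + `|b| * M^-1.
  move=> M2 /(far M)[[x y] [[u v] /= [xy1 Mxy uvc xu yv]]].
  have [sM Mx] := C3_far xy1 M2 Mxy.
  exists x; split => //.
  rewrite (_ : _ - c = a * (x - u) + b * (y - v) - b * (x + y)); last first.
    by rewrite -uvc; ring.
  rewrite (le_trans (ler_normB _ _))// lerD//; last first.
    by rewrite normrM ler_wpM2l.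
  rewrite (le_trans (ler_normD _ _))// /K mulrDl !normrM.
  by rewrite lerD// ler_wpM2l// ltW.
have ab : a = b.
  apply/eqP; apply: contraT; rewrite -subr_eq0 -normr_gt0 => ab.
  set B := `|c| + K + `|b|.
  have B0 : 0 <= B by rewrite !addr_ge0.
  (* Makes |a - b| (M - 1) equal to |a - b| + B, above the bound B. *)
  set M := 2 + B / `|a - b|.
  have M2 : 2 <= M by rewrite lerDl divr_ge0// ltW.
  have [x [Mx]] := bound M 1 M2 ltr01.
  have M1 : M^-1 <= 1 by rewrite invf_le1//; lra.
  have : `|b| * M^-1 <= `|b| by rewrite ler_piMr.
  have : `|(a - b) * x| <= `|(a - b) * x - c| + `|c|.
    by rewrite -{1}[_ * x](subrK c) ler_normD.
  have : `|a - b| * (M - 1) <= `|(a - b) * x| by rewrite normrM ler_wpM2l.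
  have -> : `|a - b| * (M - 1) = `|a - b| + B.
    by rewrite /M; field; rewrite gt_eqF.
  rewrite /B; lra.
split => //; apply/eqP; rewrite -normr_eq0 eq_le normr_ge0 andbT.
apply/ler_addgt0Pl => d d0; rewrite addr0.
set M := 2 + 2 * `|b| / d.
have M2 : 2 <= M by rewrite lerDl divr_ge0 ?mulr_ge0// ltW.
(* With this M and this e, each of the two error terms is at most d / 2. *)
have e0 : 0 < d / (2 * (K + 1)) by rewrite divr_gt0//; lra.
have [x [_]] := bound M _ M2 e0.
rewrite ab subrr mul0r sub0r normrN => /le_trans; apply.
have H1 : K * (d / (2 * (K + 1))) <= d / 2.
  rewrite mulrA ler_pdivrMr; last lra.
  nra.
have H2 : `|b| * M^-1 <= d / 2.
  rewrite ler_pdivrMr; last lra.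
  rewrite (_ : d / 2 * M = d + `|b|); first lra.
  by rewrite /M; field; rewrite gt_eqF.
lra.
Qed.

Lemma asymptote_C3_unique (L : set (R * R)) :
  asymptote (C3 R) L -> L = [set p | p.1 + p.2 = 0].
Proof.
move=> [[a [b [c [ab0 LE]]]] [g [_ gC goo gL]]].
have [ab c0] : a = b /\ c = 0.
  apply: (line_far ab0) => M e e0.
  have gLe : \forall t \near +oo, (edist_inf L (g t) < e%:E)%E.
    by apply: (gL [set z | (z < e%:E)%E]); apply: open_ereal_lt'; rewrite lte_fin.
  have : \forall t \near +oo, [/\ 0 <= t, M <= `|g t| & (edist_inf L (g t) < e%:E)%E].
    near=> t; split.
    - by near: t; exact: nbhs_pinfty_ge.
    - by near: t; move/cvgryPge : goo; exact.
    - by near: t; exact: gLe.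
  case=> t0 [_ /(_ (t0 + 1))]; rewrite ltrDl => /(_ ltr01) [t1 Mt].
  move=> /ereal_inf_lt[_ [q Lq <-]] /edist_lt_ball[/= b1 b2].
  exists (g (t0 + 1)), q; split => //; first exact: gC.
  by move: Lq; rewrite LE.
have b0 : b != 0.
  by apply: contraNneq ab0 => b0; rewrite ab b0.
rewrite LE; apply/seteqP; split => p /=; rewrite ab c0 -mulrDr.
  by move/eqP; rewrite mulf_eq0 (negbTE b0) => /eqP.
by move=> ->; rewrite mulr0.
Unshelve. all: by end_near. Qed.

Lemma asymptote_C3_antidiagonal : asymptote (C3 R) [set p | p.1 + p.2 = 0].
Proof.
split.
  exists 1, 1, 0; split; first by apply/eqP => -[/eqP]; rewrite oner_eq0.
  by apply/seteqP; split => p /=; rewrite !mul1r.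
(* The arc in the fourth quadrant, starting at (1, 0); the point of the line
   below the same abscissa gives the bound on the distance. *)
exists (fun t => (1 + t, - arc4 (1 + t))); split.
- apply: continuous_subspaceT => t.
  have ct : 1 + s @[s --> t] --> 1 + t by exact: cvgD (cvg_cst _) cvg_id.
  have cz : arc4 (1 + s) @[s --> t] --> arc4 (1 + t).
    apply: (@continuous_comp _ _ _ (fun s : R => 1 + s) arc4) => //.
    exact: continuous_arc4.
  exact: cvg_pair ct (cvgN cz).
- move=> t t0; rewrite /C3/= exprNn -signr_odd/= expr1 mulN1r arc4K ?lerDl//.
  ring.
- apply/cvgryPge => A; near=> t.
  have t0 : 0 <= t by near: t; exact: nbhs_pinfty_ge.
  have At : A <= t by near: t; apply: nbhs_pinfty_ge; exact: num_real.
  rewrite /Num.norm/= le_max; apply/orP; left.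
  by rewrite ger0_norm ?addr_ge0// -[leLHS]add0r lerD.
- apply: (@squeeze_cvge _ _ _ _ (fun=> 0%E) _ (fun t => (t^-1)%:E)).
  + near=> t; have t0 : 0 < t by near: t; exact: nbhs_pinfty_gt.
    rewrite edist_inf_ge0/=.
    apply: (@le_trans _ _ (edist ((1 + t, - arc4 (1 + t)), (1 + t, - (1 + t))))).
      by apply: ereal_inf_lbound; exists (1 + t, - (1 + t)) => //=; rewrite subrr.
    have x1 : 1 <= 1 + t by rewrite lerDl ltW.
    have x0 : 0 < 1 + t by lra.
    apply: edist_fin; first by rewrite invr_gt0.
    split => /=; rewrite /ball/= ?subrr ?normr0 ?invr_gt0//.
    rewrite opprK addrC ger0_norm ?subr_ge0 ?arc4_le ?(ltW x0)//.
    apply: (le_lt_trans (sub_arc4_le x1)).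
    rewrite ltf_pV2 ?posrE ?exprn_gt0//; nra.
  + exact: cvg_cst.
  + by apply: cvg_EFin; [near=> t|exact: cvg_inv_pinfty].
Unshelve. all: by end_near. Qed.

End asymptote_of_C3.

Theorem mainTheorem2 (R : realType) :
  (* the asymptote of C_3 is the line x + y = 0 *)
  (forall L : set (R * R),
     asymptote (C3 R) L <-> L = [set p | p.1 + p.2 = 0]) /\
  let D1 := region3 R `&` quadrant1 R in
  let D2 := region3 R `&` quadrant2 R in
  let D4 := region3 R `&` quadrant4 R in
  (* the axes divide the region into the three parts D1, D2, D4 *)
  [/\ region3 R = D1 `|` D2 `|` D4,
      D1 `&` D2 `<=` axes R,
      D1 `&` D4 `<=` axes R &
      D2 `&` D4 `<=` axes R] /\
  [/\ borel2 D1, borel2 D2 & borel2 D4] /\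
  (* the three parts have equal finite area, a third of the whole *)
  [/\ area D1 = area D2,
      area D2 = area D4,
      (area D1 < +oo)%E &
      area (region3 R) = (area D1 + area D2 + area D4)%E].
Proof.
split.
  move=> L; split; first exact: asymptote_C3_unique.
  by move=> ->; exact: asymptote_C3_antidiagonal.
set D1 := _ `&` quadrant1 R; set D2 := _ `&` quadrant2 R.
set D4 := _ `&` quadrant4 R => /=.
have RD : region3 R = D1 `|` D2 `|` D4.
  apply/seteqP; split => [[x y] [/= s c]|p [[|]|] []//].
  have [x0|x0] := leP 0 x; have [y0|y0] := leP 0 y.
  - by left; left.
  - by right; split => //; split => //; exact: ltW.
  - by left; right; split => //; split => //; exact: ltW.
  - lra.
have D12 : D1 `&` D2 `<=` axes R.
  by move=> [x y] /= [[_ [/= x0 _]] [_ [/= x1 _]]]; left => /=; lra.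
have D14 : D1 `&` D4 `<=` axes R.
  by move=> [x y] /= [[_ [/= _ y0]] [_ [/= _ y1]]]; right => /=; lra.
have D24 : D2 `&` D4 `<=` axes R.
  by move=> [x y] /= [[_ [/= x0 _]] [_ [/= x1 _]]]; left => /=; lra.
have b1 : borel2 D1 by exact: measurableI borel2_region3 borel2_quadrant1.
have b2 : borel2 D2 by exact: measurableI borel2_region3 borel2_quadrant2.
have b4 : borel2 D4 by exact: measurableI borel2_region3 borel2_quadrant4.
split=> //; split=> //.
have D12oo : (area (D1 `|` D2) < +oo)%E.
  by rewrite area_setU// area_D1 ?area_D2 ?ltry// -EFinD ltry.
split.
- by rewrite area_D1 area_D2.
- by rewrite area_D2 area_D4.
- by rewrite area_D1 ltry.
- rewrite RD area_setU//; first by rewrite area_setU// area_D1 ltry.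
    exact: measurableU.
  by rewrite setIUl => p [/D14|/D24].
Qed.
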